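(* Let $\pi\in\mathbb{R}^n\setminus\{0\}$, $\pi_0<\pi_1$ real, and $F=\{x\in\mathbb{R}^n:\pi_0\le\pi^Tx\le\pi_1\}$. Let $g:\mathbb{R}^n\to\mathbb{R}$ be a positive homogeneous convex function and $f:\mathbb{R}\to\mathbb{R}\cup\{+\infty\}$ a closed convex function such that $f(\pi_0)\le 0$ and $f(\pi_1)\le 0$. Let $$L_{g,f}=\{x\in\mathbb{R}^n: g(P_\pi^\perp x)+f(\pi^Tx)\le 0\},$$ $a=\frac{f(\pi_1)-f(\pi_0)}{\pi_1-\pi_0}$ and $b=\frac{\pi_1f(\pi_0)-\pi_0f(\pi_1)}{\pi_1-\pi_0}$. Then $$\mathrm{conv}\bigl(L_{g,f}\setminus \mathrm{int}(F)\bigr)=L_{g,f}\cap C,\qquad C=\{x\in\mathbb{R}^n: g(P_\pi^\perp x)+a\,\pi^Tx+b\le 0\}.$$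
   Context: $P_\pi^\perp=I-\frac{\pi\pi^T}{\|\pi\|_2^2}$ is the orthogonal projection onto the orthogonal complement of $\pi$. Positive homogeneous means $g(\lambda x)=\lambda g(x)$ for all $\lambda>0$. A closed convex function is a convex function with closed epigraph. $\mathrm{int}$ is the topological interior and $\mathrm{conv}$ the convex hull. *)

(* Defs.v *)
From mathcomp Require Import all_boot all_order all_algebra.
From mathcomp Require Import all_classical all_reals all_analysis.
Set Implicit Arguments.
Unset Strict Implicit.
Unset Printing Implicit Defensive.
Import Order.TTheory GRing.Theory Num.Theory.
Import numFieldNormedType.Exports.
Local Open Scope classical_set_scope.
Local Open Scope ring_scope.

(* Vectors of R^n are columns.  The library norm on matrices is the sup norm,
   hence the explicit Euclidean norm. *)
Definition dotp (R : realType) (n : nat) (u v : 'cV[R]_n) : R :=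
  (u^T *m v) ord0 ord0.

Definition l2norm (R : realType) (n : nat) (u : 'cV[R]_n) : R :=
  Num.sqrt (\sum_i u i ord0 ^+ 2).

Definition orthproj (R : realType) (n : nat) (pi : 'cV[R]_n) : 'M[R]_n :=
  1%:M - (l2norm pi ^+ 2)^-1 *: (pi *m pi^T).

Definition positive_homogeneous (R : realType) (n : nat)
    (g : 'cV[R]_n -> R) : Prop :=
  forall (lambda : R) (x : 'cV[R]_n),
    0 < lambda -> g (lambda *: x) = lambda * g x.

(* Meant for f with values in R \cup {+oo}; the absence of -oo is a separate
   hypothesis.  For t = 0 or 1 the convention 0 * +oo = 0 makes the
   inequality trivial. *)
Definition convex_efunction (R : realType) (f : R -> \bar R) : Prop :=
  forall (t : {i01 R}) (x y : R),
    (f (t%:num * x + (1 - t%:num) * y)%R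
       <= t%:num%:E * f x + (1 - t%:num)%:E * f y)%E.

Definition epigraph (R : realType) (f : R -> \bar R) : set (R * R) :=
  [set z | (f z.1 <= z.2%:E)%E].

Definition closed_convex (R : realType) (f : R -> \bar R) : Prop :=
  convex_efunction f /\ closed (epigraph f).

Definition convex_hull (R : realType) (n : nat) (A : set 'cV[R]_n) :
    set 'cV[R]_n :=
  smallest (@convex_set R 'cV[R]_n) A.

Definition split_set (R : realType) (n : nat) (pi : 'cV[R]_n) (pi0 pi1 : R) :
    set 'cV[R]_n :=
  [set x | pi0 <= dotp pi x <= pi1].

Definition Lset (R : realType) (n : nat) (pi : 'cV[R]_n)
    (g : 'cV[R]_n -> R) (f : R -> \bar R) : set 'cV[R]_n :=
  [set x | ((g (orthproj pi *m x))%:E + f (dotp pi x) <= 0)%E].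

(* Affine interpolation of f between pi0 and pi1; [fine] reads f pi0 and
   f pi1 as reals, and is only used where they are finite. *)
Definition coef_a (R : realType) (f : R -> \bar R) (pi0 pi1 : R) : R :=
  (fine (f pi1) - fine (f pi0)) / (pi1 - pi0).

Definition coef_b (R : realType) (f : R -> \bar R) (pi0 pi1 : R) : R :=
  (pi1 * fine (f pi0) - pi0 * fine (f pi1)) / (pi1 - pi0).

Definition Cset (R : realType) (n : nat) (pi : 'cV[R]_n)
    (g : 'cV[R]_n -> R) (a b : R) : set 'cV[R]_n :=
  [set x | g (orthproj pi *m x) + a * dotp pi x + b <= 0].

(* Main.v *)
(** [L] and [C] are convex, and outside the open slab [f] lies above its chord
  through [pi0] and [pi1], so [L] minus the interior of [F] is contained in [C].
  Conversely, let [x] be in [C] and in the open slab, put [y = P x] and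
  [s = - (a * dotp pi x + b)], which is nonnegative as a convex combination of
  [- f pi0] and [- f pi1].  If [s > 0], then by homogeneity of [g] the points
  with [pi]-coordinates [pi0], [pi1] and orthogonal parts [(- f pi0 / s) y],
  [(- f pi1 / s) y] lie in [L], and [x] is between them; if [s = 0], then
  [f pi0 = f pi1 = 0] and both orthogonal parts can be taken equal to [y]. *)
Require Import Defs.
From mathcomp Require Import all_boot all_order all_algebra.
From mathcomp Require Import all_classical all_reals all_analysis.
From mathcomp Require Import ring lra.
Import Order.TTheory GRing.Theory Num.Theory.
Import numFieldNormedType.Exports.
Local Open Scope classical_set_scope.
Local Open Scope ring_scope.

Lemma dotpE (R : realType) (n : nat) (u v : 'cV[R]_n) :
  dotp u v = \sum_i u i ord0 * v i ord0.
Proof. by rewrite /dotp mxE; apply: eq_bigr => i _; rewrite mxE. Qed.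

Lemma dotpDr (R : realType) (n : nat) (u v w : 'cV[R]_n) :
  dotp u (v + w) = dotp u v + dotp u w.
Proof. by rewrite /dotp mulmxDr mxE. Qed.

Lemma dotpZr (R : realType) (n : nat) (u v : 'cV[R]_n) (c : R) :
  dotp u (c *: v) = c * dotp u v.
Proof. by rewrite /dotp -scalemxAr mxE. Qed.

Lemma dotp_gt0 (R : realType) (n : nat) (u : 'cV[R]_n) : u != 0 -> 0 < dotp u u.
Proof.
move=> u0; have ge0 i : true -> 0 <= u i ord0 * u i ord0.
  by move=> _; rewrite -expr2 sqr_ge0.
rewrite dotpE lt_neqAle sumr_ge0 // andbT eq_sym.
apply: contraNneq u0 => /eqP; rewrite psumr_eq0 // => /allP u0.
apply/eqP/matrixP => i j; rewrite mxE (ord1 j).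
by have := u0 i (mem_index_enum _); rewrite /= mulf_eq0 orbb => /eqP.
Qed.

Lemma orthprojE (R : realType) (n : nat) (pi x : 'cV[R]_n) :
  orthproj pi *m x = x - (dotp pi x / dotp pi pi) *: pi.
Proof.
rewrite /orthproj mulmxBl mul1mx -scalemxAl -mulmxA.
have -> : l2norm pi ^+ 2 = dotp pi pi.
  rewrite /l2norm sqr_sqrtr ?sumr_ge0 // => [|i _]; last exact: sqr_ge0.
  by rewrite dotpE; apply: eq_bigr => i _; rewrite expr2.
have -> : pi^T *m x = (dotp pi x)%:M.
  by apply/matrixP => i j; rewrite !ord1 [RHS]mxE eqxx mulr1n.
by rewrite mul_mx_scalar scalerA mulrC.
Qed.

Lemma dotp_orthproj (R : realType) (n : nat) (pi x : 'cV[R]_n) :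
  pi != 0 -> dotp pi (orthproj pi *m x) = 0.
Proof.
move=> /dotp_gt0 /lt0r_neq0 pi0.
by rewrite orthprojE -scaleNr dotpDr dotpZr mulNr divfK // subrr.
Qed.

Lemma convex_hullP {R : realType} {n : nat} (A B : set 'cV[R]_n) :
  A `<=` B -> @convex_set R 'cV[R]_n B -> convex_hull A `<=` B.
Proof. by move=> AB cB; apply: smallest_sub. Qed.

Lemma convex_hull_segment {R : realType} {n : nat} (A : set 'cV[R]_n)
    (x y : 'cV[R]_n) (t : R) :
  A x -> A y -> 0 <= t -> t <= 1 -> convex_hull A (t *: x + (1 - t) *: y).
Proof.
move=> Ax Ay t0 t1 B [cB AB].
have := cB x y (Itv01 t0 t1); rewrite !inE; apply; exact: AB.
Qed.

Lemma convex_functionP {R : realType} {n : nat} (g : 'cV[R]_n -> R) :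
  @convex_function R 'cV[R]_n setT g -> forall (t : {i01 R}) x y,
  g (t%:num *: x + (1 - t%:num) *: y) <= t%:num * g x + (1 - t%:num) * g y.
Proof. by move=> cg t x y; apply: (cg t x y); rewrite inE. Qed.

Lemma dotp_continuous (R : realType) (n : nat) (u : 'cV[R]_n) :
  continuous (dotp u).
Proof.
have -> : dotp u = fun v => \sum_(i <- index_enum 'I_n) u i ord0 * v i ord0.
  by apply/funext => v; rewrite dotpE.
elim: (index_enum _) => [|i s IH].
  under eq_fun do rewrite big_nil.
  exact: cst_continuous.
under eq_fun do rewrite big_cons.
(* [Filter] is not inferred for neighborhoods in a generic matrix type. *)
move=> v; have Fv := nbhs_filter v.
apply: (@cvgD _ _ _ (nbhs v) Fv); last exact: IH.
apply: (@cvgMl_tmp _ _ (nbhs v) Fv); exact: coord_continuous.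
Qed.

(** Balls are taken in the sup norm, so it is enough to make every coordinate of the step smaller
    than the radius. *)
Lemma nbhs_segment (R : realType) (n : nat) (x u : 'cV[R]_n) (A : set 'cV[R]_n) :
  nbhs x A -> exists2 s : R, 0 < s & A (x - s *: u) /\ A (x + s *: u).
Proof.
move=> /nbhs_ballP[e /= e0 sub].
(* The summand 1 makes [k] positive even for [u = 0], and strictly larger than each coordinate of
   [u] in absolute value. *)
pose k := 1 + \sum_i `|u i ord0|.
have k0 : 0 < k by rewrite ltr_pwDl // sumr_ge0.
exists (e / k); first exact: divr_gt0.
have small i : `|e / k * u i ord0| < e.
  rewrite normrM gtr0_norm ?divr_gt0 // mulrAC ltr_pdivrMr // ltr_pM2l //.
  by rewrite /k (bigD1 i) //= addrCA ltrDl ltr_pwDl // sumr_ge0.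
by split; apply: sub; split=> // i j; rewrite /ball /= !mxE (ord1 j);
  [rewrite subKr|rewrite opprD addNKr normrN].
Qed.

Lemma interior_split_set (R : realType) (n : nat) (pi : 'cV[R]_n) (pi0 pi1 : R) :
  pi != 0 ->
  (split_set pi pi0 pi1)° = [set x | pi0 < dotp pi x < pi1].
Proof.
move=> /dotp_gt0 pp; apply/seteqP; split => x /=.
  (* Moving both ways along [pi] changes the [pi]-coordinate by [s * dotp pi pi > 0], which makes
     both bounds strict. *)
  move=> /(nbhs_segment _ _ _ pi)[s s0]; rewrite /split_set /= -scaleNr.
  rewrite !dotpDr !dotpZr => -[/andP[l _] /andP[_ r]].
  have := mulr_gt0 s0 pp => sp.
  apply/andP; split; lra.
move=> /andP[l r].
have ol : open_nbhs (dotp pi x) [set r | pi0 < r].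
  by split=> //; exact: open_gt.
have ou : open_nbhs (dotp pi x) [set r | r < pi1].
  by split=> //; exact: open_lt.
have nl := dotp_continuous _ _ pi x _ (open_nbhs_nbhs ol).
have nr := dotp_continuous _ _ pi x _ (open_nbhs_nbhs ou).
have Fx := nbhs_filter x.
apply: (@filterS _ (nbhs x) Fx _ _ _ (@filterI _ _ Fx _ _ nl nr)) => y [/= yl yr].
by rewrite /split_set /= !ltW.
Qed.

Lemma convex_three_points (R : realType) (f : R -> \bar R) (x y z fx fy fz : R) :
  convex_efunction f -> f x = fx%:E -> f y = fy%:E -> f z = fz%:E ->
  x <= y -> y <= z -> x < z -> (z - x) * fy <= (z - y) * fx + (y - x) * fz.
Proof.
move=> cf fxE fyE fzE xy yz xz.
have zx : 0 < z - x by lra.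
(* This quotient is the weight of [x] when [y] is written as a convex combination of [x] and [z]. *)
have t0 : 0 <= (z - y) / (z - x) by apply: divr_ge0; lra.
have t1 : (z - y) / (z - x) <= 1 by rewrite ler_pdivrMr //; lra.
have := cf (Itv01 t0 t1) x z; rewrite /= fxE fzE.
have -> : (z - y) / (z - x) * x + (1 - (z - y) / (z - x)) * z = y.
  by field; rewrite gt_eqF.
rewrite fyE -!EFinM -EFinD lee_fin -(ler_pM2l zx) => /le_trans; apply.
by rewrite le_eqVlt; apply/orP; left; apply/eqP; field; rewrite gt_eqF.
Qed.

(** A value [+oo] of [f] would violate the inequality, so membership reduces to real arithmetic. *)
Lemma LsetP (R : realType) (n : nat) (pi x : 'cV[R]_n) (g : 'cV[R]_n -> R)
    (f : R -> \bar R) : (forall t, (-oo < f t)%E) ->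
  Lset pi g f x <->
  exists2 r, f (dotp pi x) = r%:E & g (orthproj pi *m x) + r <= 0.
Proof.
move=> fNy; rewrite /Lset /=; have := fNy (dotp pi x).
case: (f _) => [r| |] // _; last by split => // -[].
by rewrite -EFinD lee_fin; split => [h|[_ [<-]]//]; exists r.
Qed.

Lemma Lset_convex (R : realType) (n : nat) (pi : 'cV[R]_n) (g : 'cV[R]_n -> R)
    (f : R -> \bar R) : (forall t, (-oo < f t)%E) ->
  @convex_function R 'cV[R]_n setT g -> convex_efunction f ->
  @convex_set R 'cV[R]_n (Lset pi g f).
Proof.
move=> fNy /convex_functionP cg cf x y t; rewrite !inE.
move=> /(LsetP _ _ _ _ _ _ fNy)[r fx gx] /(LsetP _ _ _ _ _ _ fNy)[s fy gy].
have := cf t (dotp pi x) (dotp pi y); rewrite fx fy -!dotpZr -dotpDr => fc.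
have := cg t (orthproj pi *m x) (orthproj pi *m y).
rewrite !scalemxAr -mulmxDr -lee_fin => gc.
rewrite /Lset /=; apply: le_trans (leeD gc fc) _.
rewrite -!EFinM -!EFinD lee_fin.
have : 0 <= t%:num by [].
have : 0 <= 1 - t%:num by rewrite subr_ge0.
nra.
Qed.

Lemma Cset_convex (R : realType) (n : nat) (pi : 'cV[R]_n) (g : 'cV[R]_n -> R)
    (a b : R) :
  @convex_function R 'cV[R]_n setT g ->
  @convex_set R 'cV[R]_n (Cset pi g a b).
Proof.
move=> /convex_functionP cg x y t; rewrite !inE /Cset /= => gx gy.
have := cg t (orthproj pi *m x) (orthproj pi *m y).
rewrite !scalemxAr -mulmxDr => gc.
have : 0 <= t%:num by [].
have : 0 <= 1 - t%:num by rewrite subr_ge0.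
have -> : (conv t (x : convex_lmodType 'cV[R]_n) y : 'cV[R]_n) =
  t%:num *: x + (1 - t%:num) *: y by [].
rewrite dotpDr !dotpZr; nra.
Qed.

Theorem proposition3p6 (R : realType) (n : nat) (pi : 'cV[R]_n) (pi0 pi1 : R)
    (g : 'cV[R]_n -> R) (f : R -> \bar R)
    (pi_neq0 : pi != 0)
    (lt_pi01 : pi0 < pi1)
    (g_hom : positive_homogeneous g)
    (g_convex : @convex_function R 'cV[R]_n setT g)
    (f_gtNy : forall t : R, (-oo < f t)%E)
    (f_closed_convex : closed_convex f)
    (f_pi0 : (f pi0 <= 0)%E)
    (f_pi1 : (f pi1 <= 0)%E) :
  convex_hull (Lset pi g f `\` (split_set pi pi0 pi1)°)
  = Lset pi g f `&` Cset pi g (coef_a f pi0 pi1) (coef_b f pi0 pi1).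
Proof.
case: f_closed_convex => cf _.
rewrite interior_split_set //.
have [f0 f0E f0le] : exists2 r, f pi0 = r%:E & r <= 0.
  by have := f_gtNy pi0; case: (f pi0) f_pi0 => [r| |] //; exists r.
have [f1 f1E f1le] : exists2 r, f pi1 = r%:E & r <= 0.
  by have := f_gtNy pi1; case: (f pi1) f_pi1 => [r| |] //; exists r.
have d0 : 0 < pi1 - pi0 by rewrite subr_gt0.
have chord t : coef_a f pi0 pi1 * t + coef_b f pi0 pi1 =
    ((pi1 - t) * f0 + (t - pi0) * f1) / (pi1 - pi0).
  by rewrite /coef_a /coef_b f0E f1E /=; ring.
apply/seteqP; split.
  apply: convex_hullP => [x [Lx /negP nx]|].
    split=> //; rewrite /Cset /= -addrA chord.
    case/(LsetP _ _ _ _ _ _ f_gtNy): Lx => r fr gr.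
    suff : ((pi1 - dotp pi x) * f0 + (dotp pi x - pi0) * f1) / (pi1 - pi0) <= r.
      by lra.
    rewrite ler_pdivrMr //.
    move: nx; rewrite negb_and -!leNgt => /orP[le0|le1].
      (* Here [pi0] lies between [dotp pi x] and [pi1]: the convexity bound at the middle point
         [pi0] becomes a lower bound for [r]. *)
      have := convex_three_points _ _ _ _ _ _ _ _ cf fr f0E f1E le0
        (ltW lt_pi01) (le_lt_trans le0 lt_pi01).
      lra.
    have := convex_three_points _ _ _ _ _ _ _ _ cf f0E f1E fr
      (ltW lt_pi01) le1 (lt_le_trans lt_pi01 le1).
    lra.
  move=> x y t; rewrite !inE => -[Lx Cx] [Ly Cy]; split.
    by apply/set_mem/Lset_convex; rewrite ?inE.
  by apply/set_mem/Cset_convex; rewrite ?inE.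
move=> x [Lx]; rewrite /Cset /= -addrA chord => Cx.
have [/andP[lt0 lt1]|nx] := boolP (pi0 < dotp pi x < pi1); last first.
  by apply: sub_gen_smallest; split => //; apply/negP.
set y := orthproj pi *m x in Cx.
pose lift s c : 'cV[R]_n := c *: y + (s / dotp pi pi) *: pi.
have pp := lt0r_neq0 (dotp_gt0 _ _ _ pi_neq0).
(* [lift s c] is the point with [pi]-coordinate [s] and orthogonal part [c *: y]. *)
have dotp_lift s c : dotp pi (lift s c) = s.
  by rewrite dotpDr !dotpZr dotp_orthproj // mulr0 add0r divfK.
have proj_lift s c : orthproj pi *m lift s c = c *: y.
  by rewrite orthprojE dotp_lift addrK.
have liftL s c r : f s = r%:E -> ~~ (pi0 < s < pi1) -> g (c *: y) + r <= 0 ->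
    (Lset pi g f `\` [set x | pi0 < dotp pi x < pi1]) (lift s c).
  move=> fs ns gs; split; last by rewrite /= dotp_lift; apply/negP.
  by apply/LsetP => //; exists r; rewrite ?dotp_lift ?proj_lift.
(* The weight of [pi0] in [dotp pi x = t * pi0 + (1 - t) * pi1]. *)
pose t := (pi1 - dotp pi x) / (pi1 - pi0).
have t0 : 0 < t by apply: divr_gt0; lra.
have t1 : t < 1 by rewrite ltr_pdivrMr //; lra.
have {}Cx : g y + (t * f0 + (1 - t) * f1) <= 0.
  suff -> : t * f0 + (1 - t) * f1 =
    ((pi1 - dotp pi x) * f0 + (dotp pi x - pi0) * f1) / (pi1 - pi0) by [].
  by rewrite /t; field; rewrite gt_eqF.
have g0 : g 0 = 0.
  by have := g_hom 2 0 (ltr0Sn _ _); rewrite scaler0; lra.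
(* The weighted mean 1 makes the orthogonal parts of the two lifts combine to [y]. *)
have [c0 [c1 [c01 gc0 gc1]]] : exists c0 c1, [/\ t * c0 + (1 - t) * c1 = 1,
    g (c0 *: y) + f0 <= 0 & g (c1 *: y) + f1 <= 0].
  have [s0|s0] := ltP (t * f0 + (1 - t) * f1) 0.
    (* This normalization gives [- f0 / s] and [- f1 / s] weighted mean 1, and [Cx] reads
       [g y <= s]. *)
    pose s := - (t * f0 + (1 - t) * f1).
    have s_gt0 : 0 < s by rewrite oppr_gt0.
    have scale r : r <= 0 -> g ((- r / s) *: y) + r <= 0.
      (* For [r = 0] the factor is 0, where homogeneity says nothing and [g0] is used instead. *)
      rewrite le_eqVlt => /predU1P[->|r0].
        by rewrite oppr0 mul0r scale0r g0 addr0.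
      have k0 : 0 < - r / s by apply: divr_gt0; rewrite ?oppr_gt0.
      rewrite g_hom // -lerBrDr sub0r mulrAC ler_pdivrMr // ler_pM2l ?oppr_gt0 //.
      by rewrite /s; lra.
    exists (- f0 / s), (- f1 / s); split; [|exact: scale|exact: scale].
    rewrite /s; field; exact: ltr0_neq0.
  (* Both weights are positive and both values nonpositive, so a nonnegative weighted sum forces
     each value to vanish. *)
  have f00 : f0 = 0 by nra.
  have f10 : f1 = 0 by nra.
  by exists 1, 1; rewrite f00 f10 scale1r; split; [ring|nra|nra].
have -> : x = t *: lift pi0 c0 + (1 - t) *: lift pi1 c1.
  rewrite /lift !scalerDr !scalerA addrACA -!scalerDl c01 scale1r.
  have -> : t * (pi0 / dotp pi pi) + (1 - t) * (pi1 / dotp pi pi) =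
      dotp pi x / dotp pi pi.
    by rewrite /t; field; rewrite pp gt_eqF.
  by rewrite /y orthprojE subrK.
apply: convex_hull_segment; [| |exact: ltW|exact: ltW].
  by apply: liftL f0E _ gc0; rewrite ltxx.
by apply: liftL f1E _ gc1; rewrite ltxx andbF.
Qed.
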